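(* For any $m\in\mathbb{Z}$, $k\in\mathbb{Z}_{\geq0}$ and $c\in\mathbb{R}$, $$\underline{\mu}^c\left(\left\{\underline z:N^{\rightarrow h}_{m+\frac12}(\underline{z})=k\right\}\right)=\underline{\mu}^{2m+1-c}\left(\left\{\underline z:N^{\leftarrow p}_{m+\frac12}(\underline{z})=k\right\}\right).$$
   Context: Fix $q\in(0,1)$. For $c\in\mathbb{R}$, the blocking measure $\underline{\mu}^c$ of the asymmetric simple exclusion process (ASEP) is the product probability measure on $\{0,1\}^{\mathbb{Z}}$ under which the coordinates $z_i$ are independent with $\underline\mu^c(z_i=1)=\frac{q^{c-i}}{1+q^{c-i}}$. For $m\in\mathbb{Z}$, $N^{\leftarrow p}_{m+\frac12}(\underline z)=\sum_{i=-\infty}^m z_i$ is the number of particles to the left of $m+\frac12$, and $N^{\rightarrow h}_{m+\frac12}(\underline z)=\sum_{i=m+1}^\infty(1-z_i)$ is the number of holes to the right of $m+\frac12$; both are finite $\underline\mu^c$-a.s. *)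

(* Defs.v *)
From HB Require Import structures.
From mathcomp Require Import all_boot all_order all_algebra finmap.
From mathcomp Require Import all_classical all_reals all_analysis measurable_realfun.
From mathcomp Require Import ring lra.

Set Implicit Arguments.
Unset Strict Implicit.
Unset Printing Implicit Defensive.

Import Order.TTheory GRing.Theory Num.Theory.

Local Open Scope classical_set_scope.
Local Open Scope ring_scope.

Definition cylinder (J : {fset int}) (B : int -> set bool) : set (int -> bool) :=
  [set z | forall i, i \in J -> B i (z i)].

(* {0,1}^Z with its product sigma-algebra *)
Definition config : Type := g_sigma_algebraType
  [set cylinder J B | J in [set: {fset int}] & B in [set: int -> set bool]].

HB.instance Definition _ := Measurable.on config.

Section product_bernoulli.
Context {R : realType}.

Definition independent_coordinates (P : probability config R) : Prop :=
  forall (J : {fset int}) (B : int -> set bool),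
    P [set z : config | forall i, i \in J -> B i (z i)] =
    (\prod_(i <- J) P [set z : config | B i (z i)])%E.

Definition is_product_bernoulli (p : int -> R) (P : probability config R) : Prop :=
  independent_coordinates P /\ forall i, P [set z : config | z i] = (p i)%:E.

End product_bernoulli.

(* Existence of the product measure: cut [0, 1[ successively, the n-th cut
   dividing each current interval in proportions 1 - p n and p n. The sequence
   of sides taken by a Lebesgue-uniform point is a sequence of independent
   Bernoulli(p n) variables. *)
Section binary_splitting.
Context {R : realType} (p : nat -> R) (p01 : forall n, 0 <= p n <= 1).

Definition cut n (ab : R * R) := ab.1 + (1 - p n) * (ab.2 - ab.1).

Definition subcell n ab (t : bool) : R * R :=
  if t then (cut n ab, ab.2) else (ab.1, cut n ab).

Fixpoint cell (w : nat -> bool) n : R * R :=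
  if n is n'.+1 then subcell n' (cell w n') (w n') else (0, 1).

Fixpoint state (x : R) n : R * R :=
  if n is n'.+1 then subcell n' (state x n') (cut n' (state x n') <= x)
  else (0, 1).

Definition digit x n : bool := cut n (state x n) <= x.

Lemma cell_le w n : (cell w n).1 <= (cell w n).2.
Proof.
elim: n => [|n IH] /=; first exact: ler01.
have /andP[p0 p1] := p01 n.
by rewrite /subcell/cut; case: (w n) => /=; nra.
Qed.

Lemma cell_len w n :
  (cell w n).2 - (cell w n).1 = \prod_(k < n) bernoulli_pmf (p k) (w k).
Proof.
elim: n => [|n IH]; first by rewrite big_ord0 /= subr0.
rewrite big_ord_recr /= -IH /subcell /cut /bernoulli_pmf.
by case: (w n) => /=; ring.
Qed.

Lemma eq_cell w w' n : (forall k, (k < n)%N -> w k = w' k) -> cell w n = cell w' n.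
Proof.
elim: n => //= n IH h; rewrite IH ?h// => k kn; exact/h/ltnW.
Qed.

Lemma state_cell x n : state x n = cell (digit x) n.
Proof. by elim: n => //= n <-. Qed.

Lemma cell_sub w n : 0 <= (cell w n).1 /\ (cell w n).2 <= 1.
Proof.
elim: n => [|n [IH1 IH2]] //=.
have /andP[p0 p1] := p01 n; have := cell_le w n.
by rewrite /subcell/cut; case: (w n) => /= ?; split => //; nra.
Qed.

Lemma digit_cell x w n : 0 <= x < 1 ->
  (forall k, (k < n)%N -> digit x k = w k) <-> (cell w n).1 <= x < (cell w n).2.
Proof.
move=> x01; elim: n => [|n IH]; first by split.
have step : (forall k, (k < n)%N -> digit x k = w k) ->
    digit x n = (cut n (cell w n) <= x).
  by move=> h; rewrite /digit state_cell (eq_cell h).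
have /andP[p0 p1] := p01 n; have le12 := cell_le w n.
split=> [h|].
  have hn : forall k, (k < n)%N -> digit x k = w k by move=> k kn; exact/h/ltnW.
  have /andP[a1 a2] := (IH.1 hn); have := step hn.
  rewrite (h n (ltnSn n)) /= /subcell; case: (w n) => /= /esym.
    by move=> ->.
  by move=> /negbT; rewrite -ltNge a1 => ->.
move=> /= hx.
have hn : forall k, (k < n)%N -> digit x k = w k.
  apply/IH; move: hx; rewrite /subcell /cut; case: (w n) => /= /andP[h1 h2].
    by apply/andP; split=> //; nra.
  by apply/andP; split=> //; nra.
move=> k; rewrite ltnS leq_eqVlt => /orP[/eqP ->|]; last exact: hn.
rewrite (step hn); move: hx; rewrite /subcell; case: (w n) => /= /andP[h1 h2].
  by rewrite h1.
by apply/negbTE; rewrite -ltNge.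
Qed.

Lemma measurable_cut n : measurable_fun setT (fun x : R => cut n (state x n)) /\
  (measurable_fun setT (fun x : R => (state x n).1) /\
   measurable_fun setT (fun x : R => (state x n).2)).
Proof.
have cutP : forall k, (measurable_fun setT (fun x : R => (state x k).1) /\
   measurable_fun setT (fun x : R => (state x k).2)) ->
   measurable_fun setT (fun x : R => cut k (state x k)).
  move=> k [m1 m2]; apply: measurable_funD => //.
  by apply: measurable_funM => //; exact: measurable_funB.
suff H : measurable_fun setT (fun x : R => (state x n).1) /\
   measurable_fun setT (fun x : R => (state x n).2) by split => //; exact: cutP.
elim: n => [|n IH] /=; first by split; exact: measurable_cst.
have mb : measurable_fun setT (fun x : R => cut n (state x n) <= x).
  by apply: measurable_fun_ler => //; exact: cutP.
have E1 : (fun x : R => (subcell n (state x n) (cut n (state x n) <= x)).1) =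
  fun x => if cut n (state x n) <= x then cut n (state x n) else (state x n).1.
  by apply/funext => x; rewrite /subcell; case: ifP.
have E2 : (fun x : R => (subcell n (state x n) (cut n (state x n) <= x)).2) =
  fun x => if cut n (state x n) <= x then (state x n).2 else cut n (state x n).
  by apply/funext => x; rewrite /subcell; case: ifP.
rewrite E1 E2; split.
  by apply: measurable_fun_ifT => //; [exact: cutP|case: IH].
by apply: measurable_fun_ifT => //; [case: IH|exact: cutP].
Qed.

Lemma measurable_digit n : measurable_fun setT (digit ^~ n).
Proof.
by apply: measurable_fun_ler => //; have [] := measurable_cut n.
Qed.

Definition splitting_measure : {measure set _ -> \bar R} :=
  mrestr (@lebesgue_measure R) (measurable_itv `[0 : R, 1[).

Local Notation mu := splitting_measure.

Lemma mu_prefix w n :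
  mu [set x | forall k, (k < n)%N -> digit x k = w k] =
  (\prod_(k < n) bernoulli_pmf (p k) (w k))%:E.
Proof.
rewrite /mu /= /mrestr -cell_len.
have [c0 c1] := cell_sub w n; have cle := cell_le w n.
rewrite (_ : _ `&` _ = `[(cell w n).1, (cell w n).2[%classic); last first.
  apply/seteqP; split=> x /=; rewrite !in_itv /=.
    by move=> [h x01]; apply/digit_cell.
  move=> h; have x01 : 0 <= x < 1.
    by case/andP: h => h1 h2; rewrite (le_trans c0 h1) (lt_le_trans h2 c1).
  by split => //; apply/digit_cell.
rewrite lebesgue_measure_itv /= lte_fin -EFinB.
case: ltP => // h; congr EFin; apply/esym/eqP; rewrite subr_eq0.
by rewrite eq_le h cle.
Qed.

Definition bernoulli_weight (q : R) (B : set bool) : R :=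
  `[< B true >]%:R * q + `[< B false >]%:R * (1 - q).

Lemma bernoulli_weight1 q b : bernoulli_weight q [set b] = bernoulli_pmf q b.
Proof.
have e c : `[< [set b] c >] = (c == b) by apply/asboolP/eqP.
by rewrite /bernoulli_weight !e; case: b {e} => /=; rewrite mul0r mul1r ?addr0 ?add0r.
Qed.

Definition digit_box (C : nat -> set bool) n :=
  [set x | forall k, (k < n)%N -> C k (digit x k)].

Lemma measurable_digit_box C n : measurable (digit_box C n).
Proof.
rewrite (_ : digit_box C n = \bigcap_(k in `I_n) (digit ^~ k @^-1` C k)); last first.
  by apply/seteqP; split.
apply: bigcap_measurableType => // k _; rewrite -[X in measurable X]setTI.
exact: measurable_digit.
Qed.

Lemma mu_digit_box C n : mu (digit_box C n) = (\prod_(k < n) bernoulli_weight (p k) (C k))%:E.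
Proof.
suff H r : forall m C, (m + r = n)%N ->
    (forall j, (j < m)%N -> exists b, C j = [set b]) ->
    mu (digit_box C n) = (\prod_(k < n) bernoulli_weight (p k) (C k))%:E.
  exact: (H n 0%N).
elim: r => [|r IH] m {}C.
  rewrite addn0 => -> h.
  have /choice[w hw] : forall j, exists b, (j < n)%N -> C j = [set b].
    move=> j; case: (ltnP j n) => [/h[b ->]|]; first by exists b.
    by move=> _; exists true.
  rewrite (_ : digit_box C n = [set x | forall k, (k < n)%N -> digit x k = w k]).
    by rewrite mu_prefix; congr EFin; apply: eq_bigr => k _; rewrite hw// bernoulli_weight1.
  by apply/seteqP; split=> x /= hx k kn; have := hx k kn; rewrite hw.
move=> mrn h.
have mn : (m < n)%N by rewrite -mrn -addSnnS leq_addr.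
pose Cb b := fun j => if j == m then C m `&` [set b] else C j.
have Cbne b (k : 'I_n) : k != Ordinal mn -> Cb b k = C k.
  by rewrite /Cb -val_eqE /= => /negbTE ->.
have CbE b : mu (digit_box (Cb b) n) = (\prod_(k < n) bernoulli_weight (p k) (Cb b k))%:E.
  have [Cm|Cm] := pselect (C m b); last first.
    have C0 : Cb b m = set0.
      by rewrite /Cb eqxx; apply/seteqP; split=> // c [] /[swap] ->.
    rewrite (_ : digit_box _ _ = set0); last first.
      by apply/seteqP; split=> // x /(_ m mn); rewrite C0.
    rewrite measure0 (bigD1 (Ordinal mn))//= C0 /bernoulli_weight.
    by rewrite !asboolF// !mul0r addr0 mul0r.
  apply: (IH m.+1); first by rewrite addSnnS.
  move=> j; rewrite ltnS leq_eqVlt /Cb => /orP[/eqP ->|jm].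
    by exists b; rewrite eqxx; apply/seteqP; split=> [c []//|c ->].
  by rewrite ltn_eqF//; exact: h.
have D1 (D : nat -> set bool) : \prod_(k < n) bernoulli_weight (p k) (D k) =
    bernoulli_weight (p m) (D m) * \prod_(k < n | k != Ordinal mn) bernoulli_weight (p k) (D k).
  by rewrite (bigD1 (Ordinal mn)).
have -> : digit_box C n = digit_box (Cb true) n `|` digit_box (Cb false) n.
  apply/seteqP; split=> [x hx|x [] hx k kn].
    case E : (digit x m); [left|right] => k kn; rewrite /Cb; case: eqP => [->|_];
      rewrite ?E; by [split=> //; rewrite -E; exact: hx|exact: hx].
    by have := hx k kn; rewrite /Cb; case: eqP => [->[]|].
  by have := hx k kn; rewrite /Cb; case: eqP => [->[]|].
rewrite measureU; [|exact: measurable_digit_box|exact: measurable_digit_box|].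
  rewrite [X in (X + _)%E]CbE [X in (_ + X)%E]CbE -EFinD; congr EFin.
  rewrite !D1 (eq_bigr (fun k : 'I_n => bernoulli_weight (p k) (C k))); last by move=> k /Cbne ->.
  rewrite [X in _ + _ * X](eq_bigr (fun k : 'I_n => bernoulli_weight (p k) (C k))); last first.
    by move=> k /Cbne ->.
  rewrite -mulrDl; congr (_ * _); rewrite /Cb eqxx /bernoulli_weight.
  have e b c : `[< (C m `&` [set b]) c >] = `[< C m c >] && (c == b).
    apply/idP/idP => [/asboolP[Cc cb]|/andP[/asboolP Cc /eqP cb]].
      by apply/andP; split; [exact/asboolP|exact/eqP].
    by apply/asboolP; split.
  by rewrite !e !andbT !andbF /=; ring.
apply/seteqP; split=> // x [/(_ m mn) + /(_ m mn)].
by rewrite /Cb eqxx => -[_ ->] [].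
Qed.

End binary_splitting.

Section product_measure.
Context {R : realType}.

Lemma measurable_cylinder J B : measurable (cylinder J B : set config).
Proof. by apply: sub_sigma_algebra; exists J => //; exists B. Qed.

Lemma cylinder1 i (B : int -> set bool) :
  [set z : config | B i (z i)] = cylinder [fset i]%fset B.
Proof.
apply/seteqP; split=> z /= h; first by move=> j /fset1P ->.
by apply: h; exact/fset1P.
Qed.

Lemma product_bernoulli_exists (p : int -> R) : (forall i, 0 <= p i <= 1) ->
  exists P, is_product_bernoulli p P.
Proof.
move=> p01.
pose pn k := if @pickle_inv int k is Some i then p i else 0.
have pn01 k : 0 <= pn k <= 1.
  by rewrite /pn; case: (@pickle_inv int _) => // ; rewrite lexx ler01.
pose F (x : R) : config := fun i => digit pn x (choice.pickle i).
pose C (J : {fset int}) (B : int -> set bool) k :=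
  if @pickle_inv int k is Some i then (if i \in J then B i else setT) else setT.
pose N (J : {fset int}) := (\max_(i <- J) (choice.pickle i).+1)%N.
have ltN J i : i \in J -> (choice.pickle i < N J)%N.
  by move=> iJ; rewrite /N (bigD1_seq i iJ (fset_uniq J))/= leq_max leqnn.
have FE J B : F @^-1` cylinder J B = digit_box pn (C J B) (N J).
  apply/seteqP; split=> x /= h.
    move=> k kN; rewrite /C; case E : (@pickle_inv int _) => [i|//].
    have := @pickle_invK int k; rewrite E /= => <-.
    by case: ifP => // iJ; exact: h.
  move=> i iJ; have := h (choice.pickle i); rewrite /C pickleK_inv iJ; apply.
  exact: ltN.
have mF : measurable_fun setT F.
  apply: measurability; first by [].
  move=> _ [_ [J _ [B _ <-]] <-]; rewrite setTI FE.
  exact: measurable_digit_box.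
pose mu := pushforward (splitting_measure (R := R)) F.
have muE J B : mu (cylinder J B) = (\prod_(i <- J) bernoulli_weight (p i) (B i))%:E.
  rewrite /mu /pushforward FE (mu_digit_box pn01); congr EFin.
  rewrite -(big_mkord xpredT (fun k => bernoulli_weight (pn k) (C J B k))).
  pose f k := bernoulli_weight (pn k) (C J B k).
  transitivity (\prod_(k <- map choice.pickle J) f k); last first.
    rewrite big_map big_seq [RHS]big_seq; apply: eq_bigr => i iJ.
    by rewrite /f /pn /C pickleK_inv iJ.
  have fT k : k \notin map choice.pickle J -> f k = 1.
    move=> kJ; have CT : C J B k = setT.
      rewrite /C; case E : (@pickle_inv int _) => [i|//]; case: ifP => // iJ.
      move: kJ; have := @pickle_invK int k; rewrite E /= => <-.
      by rewrite map_f.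
    by rewrite /f CT /bernoulli_weight !asboolT// !mul1r subrKC.
  rewrite (bigID [in map choice.pickle J])/= [X in _ * X]big1 ?mulr1; last first.
    by move=> k kJ; exact: fT.
  rewrite -big_filter; apply: perm_big; apply: uniq_perm.
  - by rewrite filter_uniq// iota_uniq.
  - by rewrite map_inj_uniq ?fset_uniq//; exact: (pcan_inj choice.pickleK).
  - move=> k; rewrite mem_filter mem_index_iota /=.
    case: (boolP (k \in map _ _)) => //= /mapP[i iJ ->].
    exact: ltN.
have mu1 : mu setT = 1%E.
  rewrite (_ : setT = cylinder fset0 (fun=> setT)); first by rewrite muE big_seq_fset0.
  by apply/seteqP; split.
pose Pm : {measure set config -> \bar R} :=
  measure_function_pushforward__canonical__measure_function_Measure
    (splitting_measure (R := R)) mF.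
pose P : probability config R := mnormalize Pm (dirac point).
have PE A : P A = mu A by rewrite /P /= /mnormalize [Pm _]mu1 /= onee_eq0 /= invr1 mule1.
have P1E i (B : int -> set bool) : P [set z : config | B i (z i)] = (bernoulli_weight (p i) (B i))%:E.
  by rewrite cylinder1 PE muE big_seq_fset1.
exists P; split=> [J B|i].
  rewrite [LHS]PE muE -prodEFin; apply: eq_bigr => i _; exact/esym/P1E.
transitivity (P [set z : config | [set true] (z i)]).
  by congr (P _); apply/seteqP; split.
by rewrite (P1E i (fun=> [set true])) bernoulli_weight1.
Qed.

Lemma product_bernoulli_unique (p : int -> R) (P Q : probability config R) :
  is_product_bernoulli p P -> is_product_bernoulli p Q ->
  forall A, measurable A -> P A = Q A.
Proof.
move=> [iP mP] [iQ mQ].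
have PQ1 i (B : set bool) : P [set z : config | B (z i)] = Q [set z : config | B (z i)].
  have mi : measurable ([set z : config | z i] : set config).
    rewrite (_ : [set z : config | z i] = [set z : config | (fun=> [set true]) i (z i)]).
      by rewrite (cylinder1 i (fun=> [set true])); exact: measurable_cylinder.
    by apply/seteqP; split.
  have [Bt|Bt] := pselect (B true); have [Bf|Bf] := pselect (B false).
  - rewrite (_ : [set z : config | B (z i)] = setT) ?probability_setT//.
    by apply/seteqP; split=> // z _ /=; case: (z i).
  - rewrite (_ : [set z : config | B (z i)] = [set z : config | z i]) ?mP ?mQ//.
    by apply/seteqP; split=> z /=; case: (z i).
  - rewrite (_ : [set z : config | B (z i)] = ~` [set z : config | z i]) ?probability_setC ?mP ?mQ//.
    by apply/seteqP; split=> z /=; case: (z i).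
  - rewrite (_ : [set z : config | B (z i)] = set0) ?measure0//.
    by apply/seteqP; split=> z /=; case: (z i).
apply: (@measure_unique _ R config
  [set cylinder J B | J in [set: {fset int}] & B in [set: int -> set bool]] (fun=> setT)).
- by [].
- move=> _ _ [J _ [B _ <-]] [K _ [D _ <-]].
  exists (J `|` K)%fset => //; exists (fun i => [set b | (i \in J -> B i b) /\ (i \in K -> D i b)]) => //.
  apply/seteqP; split=> z /=.
    move=> h; split=> i iJ; have := h i; rewrite in_fsetU iJ ?orbT => /(_ isT) [].
      by move=> /(_ isT).
    by move=> _ /(_ isT).
  by move=> [h1 h2] i _; split=> ?; [exact: h1|exact: h2].
- move=> _; exists fset0 => //; exists (fun=> setT) => //.
  by apply/seteqP; split.
- by rewrite bigcup_const.
- move=> _ [J _ [B _ <-]]; rewrite [LHS]iP [RHS]iQ.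
  by apply: eq_bigr => i _; exact: PQ1.
- by move=> _ /=; rewrite probability_setT ltry.
Qed.

End product_measure.

Section blocking_measure.
Context {R : realType}.

Definition blocking_density (q c : R) (i : int) : R :=
  q `^ (c - i%:~R) / (1 + q `^ (c - i%:~R)).

Lemma blocking_density01 q c i : 0 <= blocking_density q c i <= 1.
Proof.
have h := powR_ge0 q (c - i%:~R); have h1 : 0 < 1 + q `^ (c - i%:~R) by lra.
by rewrite /blocking_density divr_ge0 ?(ltW h1)//= ler_pdivrMr// mul1r lerDr.
Qed.

(* Chosen from an existence lemma; by blocking_measureP and
   product_bernoulli_unique it is the only such measure. *)
Definition blocking_measure (q c : R) : probability config R :=
  sval (cid (product_bernoulli_exists (blocking_density01 q c))).

Lemma blocking_measureP q c :
  is_product_bernoulli (blocking_density q c) (blocking_measure q c).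
Proof. exact: svalP. Qed.

Local Open Scope ereal_scope.

(* Numbers of particles left of m + 1/2 and of holes right of m + 1/2; they
   take values in the extended reals since both sums may diverge. *)
Definition particles_left (m : int) (z : config) : \bar R :=
  \esum_(i in [set i : int | (i <= m)%R]) ((z i)%:R)%:E.

Definition holes_right (m : int) (z : config) : \bar R :=
  \esum_(i in [set i : int | (m + 1 <= i)%R]) (1 - (z i)%:R)%:E.

End blocking_measure.

(* Main.v *)
(* The particle-hole reflection z |-> (i |-> 1 - z (2m + 1 - i)) exchanges the
   holes to the right of m + 1/2 with the particles to its left. It maps the
   product measure with density q^(c-i) / (1 + q^(c-i)) to the one with density
   1 / (1 + q^(c-(2m+1-i))), and this is the blocking density with parameter
   2m + 1 - c; uniqueness of the product measure concludes. *)
Require Import Defs.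
From HB Require Import structures.
From mathcomp Require Import all_boot all_order all_algebra finmap.
From mathcomp Require Import all_classical all_reals all_analysis.
From mathcomp Require Import measurable_realfun ring zify.

Import Order.TTheory GRing.Theory Num.Theory.

Local Open Scope classical_set_scope.
Local Open Scope ring_scope.

Definition particle_hole (s : int) (z : config) : config :=
  fun i => ~~ z (s - i).

Lemma reflectK (s : int) : involutive (fun i : int => s - i).
Proof. by move=> i; rewrite subKr. Qed.

(** Used twice: cylinders generate the sigma-algebra, so this gives measurability of the reflection,
    and it carries independence over to the reflected coordinates. *)
Lemma particle_hole_cylinder (s : int) (J : {fset int}) (B : int -> set bool) :
  particle_hole s @^-1` cylinder J B =
  cylinder [fset s - i | i in J]%fset (fun i => [set b | B (s - i) (~~ b)]).
Proof.
apply/seteqP; split=> z /= h.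
  by move=> _ /imfsetP[i /= iJ ->]; rewrite subKr; exact: h.
move=> i iJ; have := h (s - i); rewrite /= subKr; apply.
by apply/imfsetP; exists i.
Qed.

Lemma measurable_particle_hole (s : int) :
  measurable_fun [set: config] (particle_hole s).
Proof.
apply: measurability; first by [].
move=> _ [_ [J _ [B _ <-]] <-]; rewrite setTI particle_hole_cylinder.
exact: measurable_cylinder.
Qed.

(** Needed for [distribution P (particle_hole s)] to be a probability. *)
HB.instance Definition _ (s : int) :=
  isMeasurableFun.Build _ _ config config (particle_hole s)
    (measurable_particle_hole s).

Lemma measurable_coordinate (i : int) :
  measurable_fun setT (fun z : config => z i).
Proof.
move=> _ B _; rewrite setTI.
rewrite [X in measurable X](cylinder1 i (fun=> B)); exact: measurable_cylinder.
Qed.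

Lemma product_bernoulli_particle_hole (R : realType) (p : int -> R) (s : int)
    (P : probability config R) :
  is_product_bernoulli p P ->
  is_product_bernoulli (fun i => 1 - p (s - i)) (distribution P (particle_hole s)).
Proof.
move=> [iP mP]; split=> [J B|i].
  rewrite [LHS](_ : _ = P (particle_hole s @^-1` cylinder J B))//.
  (* Distinct sites have distinct mirror images, so the product over the reflected index set becomes
     a product over [J]. *)
  rewrite particle_hole_cylinder [LHS]iP big_imfset/=; last first.
    by move=> i j _ _ /(can_inj (reflectK s)).
  apply: eq_bigr => i _; congr (P _).
  by apply/seteqP; split=> z /=; rewrite subKr.
rewrite [LHS](_ : _ = P (~` [set z : config | z (s - i)])).
  rewrite probability_setC ?mP//.
  rewrite -[X in measurable X]setTI.
  exact: (measurable_coordinate (s - i) measurableT [set b | b]).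
by congr (P _); apply/seteqP; split=> z /= /negP.
Qed.

(** With [x = q^(c - (s - i)) > 0], both sides equal [1 / (1 + x)]: the exponent on the right is the
    opposite one, and [x^-1 / (1 + x^-1) = 1 / (1 + x)]. *)
Lemma blocking_density_particle_hole (R : realType) (q c : R) (s i : int) :
  0 < q ->
  1 - blocking_density q c (s - i) = blocking_density q (s%:~R - c) i.
Proof.
move=> q0; rewrite /blocking_density intrB.
rewrite (_ : s%:~R - c - i%:~R = - (c - (s%:~R - i%:~R))); last by ring.
rewrite powRN; set x := q `^ _.
have x0 : 0 < x by exact: powR_gt0.
by field; rewrite !gt_eqF// addr_gt0.
Qed.

(** The choice [s = 2m + 1] makes [i |-> s - i] a bijection from [i <= m] onto [i >= m + 1]. The
    sums are matched term by term, so infinite values are covered. *)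
Lemma particles_left_particle_hole (R : realType) (m : int) (z : config) :
  particles_left m (particle_hole (2 * m + 1) z) = holes_right m z :> \bar R.
Proof.
rewrite /holes_right.
rewrite (@reindex_esum _ _ _ [set i | (i <= m)%R] _ (fun i => 2 * m + 1 - i)).
  by apply: eq_esum => i _; rewrite /particle_hole; case: (z _); rewrite ?subrr ?subr0.
split=> [i /= im|i j _ _ /(can_inj (reflectK _))//|i /= im]; first by lia.
by exists (2 * m + 1 - i); [rewrite /=; lia|rewrite subKr].
Qed.

(** Enumerating the sites as [m - n] turns the sum over a set of integers into a series of
    nonnegative measurable functions. *)
Lemma measurable_particles_left (R : realType) (m : int) :
  measurable_fun setT (particles_left m : config -> \bar R).
Proof.
have -> : (particles_left m : config -> \bar R) =
    fun z => (\sum_(n <oo | n \in xpredT) ((z (m - n%:Z))%:R)%:E)%E.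
  apply/funext => z.
  rewrite nneseries_esumT; last by move=> n; rewrite lee_fin.
  apply: reindex_esum; split=> [n _ /=|n n' _ _ /=|i /= im]; [lia|lia|].
  by exists `|m - i|%N => //; lia.
apply: ge0_emeasurable_sum => [n z _ _|n _]; first by rewrite lee_fin.
apply/measurable_EFinP.
exact: (measurableT_comp (f := fun b : bool => b%:R : R) _
  (measurable_coordinate (m - n%:Z))).
Qed.

Theorem corollary2p3 (R : realType) (q : R) (hq : 0 < q < 1)
    (m : int) (k : nat) (c : R) :
  blocking_measure q c
    [set z : config | holes_right m z = k%:R%:E :> \bar R] =
  blocking_measure q (2 * m%:~R + 1 - c)
    [set z : config | particles_left m z = k%:R%:E :> \bar R].
Proof.
have /andP[q0 _] := hq.
have E : 2 * m%:~R + 1 - c = (2 * m + 1)%:~R - c by rewrite intrD intrM.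
have H := product_bernoulli_particle_hole _ _ (2 * m + 1) _
  (blocking_measureP q c).
have {}H : is_product_bernoulli (blocking_density q (2 * m%:~R + 1 - c))
    (distribution (blocking_measure q c) (particle_hole (2 * m + 1))).
  case: H => iP mP; split=> // i.
  by rewrite mP blocking_density_particle_hole// E.
transitivity (distribution (blocking_measure q c) (particle_hole (2 * m + 1))
    [set z : config | particles_left m z = k%:R%:E :> \bar R]).
  congr (blocking_measure q c _).
  by apply/seteqP; split=> z /=; rewrite particles_left_particle_hole.
apply: product_bernoulli_unique H (blocking_measureP _ _) _ _.
(* Uniqueness compares the two measures on measurable events only; this event is the preimage of a
   singleton. *)
have := measurable_particles_left R m measurableT [set k%:R%:E]
  (emeasurable_set1 _).
by rewrite setTI.
Qed.
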